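(* For all positive integers $n$ and $k$, we have $$\det_{0\le i,j\le n-1}\left(\mathcal P_{i+j}(0,k)\right)=\begin{cases} (-1)^{kn_1+\binom k2}(xy)^{k(n_1-1)(2kn_1-k+1)} & \text{if } n=2kn_1-k+1,\\ (-1)^{kn_1}(xy)^{kn_1(2kn_1-k-1)} & \text{if } n=2kn_1,\\ 0 & \text{if } n\not\equiv 0,k+1 \pmod{2k},\end{cases}$$ where $n_1$ denotes a positive integer, while for $k=0$ and all positive integers $n$ we have $$\det_{0\le i,j\le n-1}\left(\mathcal P_{i+j}(0,0)\right)=2^{n-1}(xy)^{\binom n2}.$$
   Context: $x,y$ are indeterminates. A three-step path is a lattice path in $\mathbb Z^2$ consisting of steps from $\{(1,0),(1,1),(1,-1)\}$. The steps have weights $w((1,0))=x+y$, $w((1,1))=1$, $w((1,-1))=xy$, and the weight $w(P)$ of a path $P$ is the product of the weights of its steps (the empty path has weight $1$). For integers $n\ge 0$ and $l,k$, $\mathcal P_n(l,k)=\sum_P w(P)$, where the sum is over all three-step paths $P$ from $(0,l)$ to $(n,k)$ (with no restriction about the $x$-axis). For $k=1$ the first two cases coincide and give the same value. *)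

(* Defs.v *)
From mathcomp Require Export all_boot all_order all_algebra.
From mathcomp Require Export mpoly.

Set Implicit Arguments.
Unset Strict Implicit.
Unset Printing Implicit Defensive.

Import GRing.Theory.
Local Open Scope ring_scope.

Definition three_steps : seq (int * int) :=
  [:: (1, 0); (1, 1); (1, -1)].

Definition step : finType := seq_sub three_steps.

(* A three-step path is given by its starting point and its list of steps. *)
Definition path_end (p : int * int) (P : seq step) : int * int :=
  p + \sum_(s <- P) ssval s.

Section Weights.
Variables (R : comNzRingType) (x y : R).

Definition step_weight (s : step) : R :=
  if ssval s == (1, 0) then x + y
  else if ssval s == (1, 1) then 1
  else x * y.

Definition path_weight (P : seq step) : R := \prod_(s <- P) step_weight s.

(* Generating function of the three-step paths from (0, l) to (n, k).  All of
   them have exactly n steps (see size_path), so summing over n-tuples of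
   steps loses none. *)
Definition path_sum (n : nat) (l k : int) : R :=
  \sum_(P : n.-tuple step | path_end (0, l) P == (n%:Z, k)) path_weight P.

End Weights.

Lemma size_path (n : nat) (l k : int) (P : seq step) :
  path_end (0, l) P = (n%:Z, k) -> size P = n.
Proof.
have sum1 : (\sum_(s <- P) ssval s).1 = (size P)%:Z.
  elim: P => [|s P IHP]; first by rewrite big_nil.
  rewrite big_cons /= IHP intS; congr (_ + _).
  by case: s => s /=; rewrite !inE => /or3P[] /eqP->.
by rewrite /path_end => /(congr1 fst) /=; rewrite sum1 add0r => -[].
Qed.

Definition indet_x : {mpoly int[2]} := 'X_(ord0 : 'I_2).
Definition indet_y : {mpoly int[2]} := 'X_(ord_max : 'I_2).

(* The matrix (P_{i+j}(0, k)), 0 <= i, j <= n-1, over Z[x, y]. *)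
Definition path_hankel (n : nat) (k : int) : 'M[{mpoly int[2]}]_n :=
  \matrix_(i < n, j < n) path_sum indet_x indet_y (i + j) 0 k.

(* Main.v *)
(** P_m(0, k) is the coefficient of z^k in (z + b + c / z)^m, where b = x + y
    and c = xy, so the Hankel determinant is the determinant of the bilinear
    form (p, q) |-> [z^k] (pq)(z + b + c / z) in the basis 1, t, t^2, ...  A
    change to another monic basis does not alter it.  In the Chebyshev basis
    given by t_0 = 1 and t_i(z + b + c / z) = z^i + (c / z)^i for i > 0, the
    (i, j) entry vanishes unless k is i + j or |i - j|.  For k = 0 the matrix
    is diagonal.  For k > 0 its last k rows and columns meet the rest in a
    diagonal block, which relates the sizes n and n - 2k; for n < 2k the matrix
    has a zero row (n <= k), is antidiagonal (n = k + 1), or has two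
    proportional rows (n > k + 1). *)
From HB Require Import structures.
From mathcomp Require Import zify ring.
Require Import Defs.
Set Implicit Arguments.
Unset Strict Implicit.
Unset Printing Implicit Defensive.
Import GRing.Theory.
Local Open Scope ring_scope.

(** * Moments of the path sums and the Chebyshev basis *)

Section Moments.
Variables (R : comNzRingType) (x y : R).
Local Notation mom n k := (path_sum x y n 0 k).

Lemma big_step (F : int * int -> R) :
  \sum_(s : step) F (ssval s) = F (1, 0) + F (1, 1) + F (1, -1).
Proof.
transitivity (\sum_(v <- map val (enum {: step})) F v).
  by rewrite big_map big_enum.
have -> : map val (enum {: step}) = three_steps.
  by rewrite enumT unlock; apply: val_seq_sub_enum.
by rewrite /three_steps !big_cons big_nil addr0 addrA.
Qed.

Lemma path_sum0 (k : int) : mom 0 k = (k == 0)%:R.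
Proof.
rewrite /path_sum big_mkcond (big_pred1 [tuple]) => [|P]; last first.
  by apply/esym/eqP; apply: tuple0.
rewrite /path_end /path_weight /= !big_nil addr0 xpair_eqE eqxx /= eq_sym.
by case: eqP.
Qed.

(** Split off the first step. The rest, translated back to the origin, ends lower by the vertical
    part of that step. *)
Lemma path_sumS (n : nat) (k : int) :
  mom n.+1 k = (x + y) * mom n k + mom n (k - 1) + x * y * mom n (k + 1).
Proof.
rewrite /path_sum.
have -> : \sum_(P : n.+1.-tuple step | path_end (0, 0) P == (n.+1%:Z, k))
    path_weight x y P =
  \sum_(s : step) step_weight x y s *
    \sum_(P : n.-tuple step | path_end (0, 0) P == (n%:Z, k - (ssval s).2))
      path_weight x y P.
  under [RHS]eq_bigr do rewrite big_distrr /=.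
  rewrite pair_big_dep /=.
  rewrite (reindex (fun p : step * n.-tuple step => cons_tuple p.1 p.2)) /=; last first.
    exists (fun P => (thead P, behead_tuple P)) => [[s P] _|P _] /=.
      by congr pair; apply: val_inj.
    by apply: val_inj; rewrite [in RHS](tuple_eta P).
  apply: eq_big => [[s P]|[s P] _] /=; last by rewrite /path_weight big_cons.
  rewrite /path_end !add0r big_cons.
  move: (\sum_(_ <- P) _) => [a b].
  by case: s => -[u v] /= uv; rewrite !xpair_eqE /=; move: uv;
     rewrite !inE => /or3P[] /eqP[-> ->]; lia.
under eq_bigr => s _ do rewrite /step_weight.
rewrite (big_step (fun v => (if v == (1, 0) then x + y else
   if v == (1, 1) then 1 else x * y) * 
    \sum_(P : n.-tuple step | path_end (0, 0) P == (n%:Z, k - v.2))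
      path_weight x y P)) /=.
by rewrite subr0 mul1r opprK.
Qed.

(* The coefficient of z^k in p(z + x + y + xy / z). *)
Definition moment (k : int) (p : {poly R}) : R :=
  \sum_(i < size p) p`_i * mom i k.

Lemma moment_widen (N : nat) (k : int) (p : {poly R}) : (size p <= N)%N ->
  moment k p = \sum_(i < N) p`_i * mom i k.
Proof.
move=> leN; rewrite /moment (big_ord_widen N (fun i => p`_i * mom i k)) //.
rewrite big_mkcond; apply: eq_bigr => i _.
by case: ltnP => // ?; rewrite nth_default ?mul0r.
Qed.

Lemma moment1 (k : int) : moment k 1 = (k == 0)%:R.
Proof.
by rewrite /moment size_poly1 big_ord1 coefC mul1r path_sum0.
Qed.

Fact moment_is_linear (k : int) : scalar (moment k).
Proof.
move=> a p q; pose N := maxn (size p) (size q).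
have leN : (size (a *: p + q)%R <= N)%N.
  rewrite (leq_trans (size_polyD _ _)) // geq_max leq_max leq_maxr andbT.
  by rewrite (leq_trans (size_scale_leq _ _)) // leq_maxl.
rewrite !(moment_widen (N := N)) ?leq_maxl ?leq_maxr //.
rewrite big_distrr -big_split /=; apply: eq_bigr => i _.
by rewrite coefD coefZ mulrDl mulrA.
Qed.
HB.instance Definition _ (k : int) :=
  GRing.isLinear.Build R {poly R} R _ (moment k) (moment_is_linear k).

Lemma momentXM (k : int) (p : {poly R}) : moment k ('X * p) =
  (x + y) * moment k p + moment (k - 1) p + x * y * moment (k + 1) p.
Proof.
have leN : (size ('X * p)%R <= (size p).+1)%N.
  by rewrite (leq_trans (size_polyMleq _ _)) // size_polyX.
rewrite (moment_widen _ leN) big_ord_recl coefXM mul0r add0r /moment.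
rewrite !big_distrr -!big_split /=; apply: eq_bigr => i _.
by rewrite coefXM /= path_sumS; ring.
Qed.

(* cheb i evaluates to z^i + (xy / z)^i at z + x + y + xy / z, hence the value
   2 at i = 0. *)
Fixpoint cheb2 (i : nat) : {poly R} * {poly R} :=
  if i is i'.+1 then
    let: (p, q) := cheb2 i' in (q, ('X - (x + y)%:P) * q - (x * y) *: p)
  else (2%:R, 'X - (x + y)%:P).
Definition cheb (i : nat) : {poly R} := (cheb2 i).1.

Lemma chebS (i : nat) :
  cheb i.+2 = ('X - (x + y)%:P) * cheb i.+1 - (x * y) *: cheb i.
Proof. by rewrite /cheb /=; case: (cheb2 i). Qed.

Lemma moment_cheb (i : nat) (k : int) (p : {poly R}) :
  moment k (cheb i * p) =
    moment (k - i%:Z) p + (x * y) ^+ i * moment (k + i%:Z) p.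
Proof.
(* The recurrence [chebS] has order two, so two consecutive indices are carried through the
   induction, for all [k] at once because ['X] shifts [k]. *)
suff [] : (forall k, moment k (cheb i * p) =
    moment (k - i%:Z) p + (x * y) ^+ i * moment (k + i%:Z) p) /\
  (forall k, moment k (cheb i.+1 * p) =
    moment (k - i.+1%:Z) p + (x * y) ^+ i.+1 * moment (k + i.+1%:Z) p) by [].
have momXb (q : {poly R}) (m : int) : moment m (('X - (x + y)%:P) * q) =
    moment (m - 1) q + x * y * moment (m + 1) q.
  by rewrite mulrBl linearB /= mul_polyC linearZ /= momentXM; ring.
elim: i => [|i [IH0 IH1]]; split=> // m.
- rewrite /cheb mulr_natl linearMn mul1r mulr2n.
  by congr (moment _ p + moment _ p); lia.
- rewrite chebS mulrBl -mulrA -scalerAl linearB linearZ /= momXb !IH1 IH0 !exprS.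
  rewrite (_ : m - 1 + i.+1%:Z = m + i%:Z); last by lia.
  rewrite (_ : m + 1 - i.+1%:Z = m - i%:Z); last by lia.
  rewrite (_ : m - 1 - i.+1%:Z = m - i.+2%:Z); last by lia.
  rewrite (_ : m + 1 + i.+1%:Z = m + i.+2%:Z); last by lia.
  by ring.
Qed.

(** [cheb 0] is 2, so it is replaced by 1 to obtain a monic basis. *)
Definition mcheb (i : nat) : {poly R} := if i is 0 then 1 else cheb i.

Lemma coef_mcheb (i m : nat) : (i <= m)%N -> (mcheb i)`_m = (m == i)%:R.
Proof.
suff chebP : forall m, ((i <= m)%N -> (mcheb i)`_m = (m == i)%:R) /\
    ((i < m)%N -> (cheb i.+1)`_m = (m == i.+1)%:R).
  by case: (chebP m).
elim: i => [|i IH] {}m; split; try by case: (IH m).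
- by rewrite coef1.
- by case: m => // m _; rewrite coefB coefX coefC subr0.
case: m => // m lt_im; rewrite chebS mulrBl !coefB coefZ coefXM coefCM /=.
have [_ ->] := IH m; last by lia.
have [_ ->] := IH m.+1; last by lia.
suff -> : (cheb i)`_m.+1 = 0 by rewrite !eqSS (_ : m == i = false) ?mulr0 ?subr0 //; lia.
(* For [i = 0], [cheb] and [mcheb] differ, but both are constant and only a coefficient of positive
   index is needed. *)
case: i IH lt_im => [|i] IH lt_im; first by rewrite coefMn coef1 mul0rn.
have [-> //] := IH m.+1; last exact: ltnW (ltnW lt_im).
by move=> _; rewrite gtn_eqF // ltnW.
Qed.

Lemma moment_mcheb (k : int) (j : nat) : moment k (mcheb j) =
  (k == j%:Z)%:R + (x * y) ^+ j * ((k == - j%:Z) && (0 < j)%N)%:R.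
Proof.
case: j => [|j]; first by rewrite moment1 andbF mulr0 addr0.
by rewrite -[mcheb _]mulr1 moment_cheb !moment1 andbT subr_eq0 addr_eq0.
Qed.

(** Both are Gram matrices of the form (p, q) |-> [moment k (p * q)]. The change of basis [P] is
    unitriangular by [coef_mcheb]. *)
Lemma det_hankel (n : nat) (k : int) :
  \det (\matrix_(i < n, j < n) mom (i + j) k) =
  \det (\matrix_(i < n, j < n) moment k (mcheb i * mcheb j)).
Proof.
pose P := \matrix_(i < n, j < n) (mcheb i)`_j.
have detP : \det P = 1.
  rewrite det_trig => [|]; last first.
    apply/is_trig_mxP => i j lt_ij.
    by rewrite mxE coef_mcheb ?[_ == _]gtn_eqF // ltnW.
  by rewrite big1 // => i _; rewrite mxE coef_mcheb ?eqxx.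
set H := (X in \det X = _); set M := (X in _ = \det X).
suff -> : M = P *m H *m P^T by rewrite !det_mulmx det_tr detP mul1r mulr1.
have mchebE (i : 'I_n) : mcheb i = \sum_(m < n) (mcheb i)`_m *: 'X^m.
  rewrite -poly_def; apply/polyP => m; rewrite coef_poly.
  by case: ltnP => // le_nm; rewrite coef_mcheb ?[_ == _]gtn_eqF //;
     have := ltn_ord i; lia.
have momXn m : moment k 'X^m = mom m k.
  rewrite /moment size_polyXn big_ord_recr /= big1 ?add0r => [|i _].
    by rewrite coefXn eqxx mul1r.
  by rewrite coefXn ltn_eqF ?mul0r.
apply/matrixP => i j; rewrite !mxE [in LHS](mchebE i) [in LHS](mchebE j).
rewrite mulr_sumr linear_sum /=; apply: eq_bigr => b _.
rewrite !mxE mulr_suml mulr_suml linear_sum; apply: eq_bigr => a _ /=.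
by rewrite -scalerAl -scalerAr !linearZ /= -exprD momXn !mxE; ring.
Qed.
End Moments.

(** * Determinants of the sparse matrices arising in the Chebyshev basis *)

Section SparseDeterminant.
Variables (R : comNzRingType).

(* Adding the middle block column to the last one and then subtracting the
   last one from the middle one makes the matrix block triangular, with
   diagonal blocks D, - E and F. *)
Lemma det_hook_block (m k : nat) (D : 'M[R]_m) (X : 'M_(m, k)) (Y : 'M_(k, m))
    (Z E F : 'M_k) :
  \det (block_mx (block_mx D X Y Z) (col_mx 0 E) (row_mx 0 F) 0) =
  (-1) ^+ k * \det D * \det E * \det F.
Proof.
set A := block_mx _ _ _ _.
pose U : 'M[R]_(m + k + k) := block_mx 1%:M (col_mx 0 1%:M) 0 1%:M.
pose V : 'M[R]_(m + k + k) := block_mx 1%:M 0 (row_mx 0 (- 1%:M)) 1%:M.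
have <- : \det (A *m U *m V) = \det A.
  by rewrite !det_mulmx det_ublock det_lblock !det1 !mulr1.
have -> : A *m U = block_mx (block_mx D X Y Z) (col_mx X (Z + E)) (row_mx 0 F) F.
  rewrite mulmx_block !mulmx1 !mulmx0 !addr0 mul_block_col mul_row_col.
  by rewrite !mulmx1 !mulmx0 ?add0r ?addr0 add_col_mx ?add0r ?addr0.
rewrite mulmx_block !mulmx1 !mulmx0 !add0r mul_col_row mul_mx_row.
rewrite !mulmx0 !mulmxN !mulmx1 add_row_mx addr0 subrr row_mx0.
rewrite add_block_mx !addr0 subrr opprD addNKr det_ublock det_lblock.
by rewrite -scaleN1r detZ; ring.
Qed.

Lemma det_antidiag (n : nat) :
  \det (\matrix_(i < n.+1, j < n.+1) (i + j == n)%N%:R : 'M[R]_n.+1) =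
  (-1) ^+ 'C(n.+1, 2).
Proof.
elim: n => [|n IH]; first by rewrite det_mx11 mxE.
rewrite (expand_det_row _ ord0) (bigD1 ord_max) //= big1 ?addr0 => [|j neq_j].
  rewrite mxE eqxx mul1r /cofactor.
  have -> : 'C(n.+2, 2) = (n.+1 + 'C(n.+1, 2))%N by rewrite binS bin1 addnC.
  rewrite [in RHS]exprD; congr (_ * _).
  rewrite -IH; congr (\det _); apply/matrixP => i j; rewrite !mxE /=.
  by rewrite /bump leq0n [(n.+1 <= j)%N]leqNgt ltn_ord.
by move: neq_j; rewrite -val_eqE mxE add0n => /negPf->; rewrite mul0r.
Qed.

Lemma det_proportional_rows (n : nat) (A : 'M[R]_n) (i j : 'I_n) (a : R) :
  i != j -> row i A = a *: row j A -> \det A = 0.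
Proof.
move=> neq_ij rowA.
pose B := \matrix_(m < n) (if m == i then row j A else row m A).
(* [B] is [A] with row [i] replaced by row [j], so it has two equal rows. The second summand of the
   multilinear expansion gets coefficient 0. *)
rewrite (@determinant_multilinear _ _ A B B i a 0).
- rewrite mul0r addr0 (determinant_alternate neq_ij) ?mulr0 // => m.
  by rewrite !mxE eqxx eq_sym (negPf neq_ij) !mxE.
- by rewrite rowA scale0r addr0; congr (_ *: _); rewrite rowK eqxx.
- by apply/matrixP => m l; rewrite !mxE eq_sym (negPf (neq_lift i m)) mxE.
- by apply/matrixP => m l; rewrite !mxE eq_sym (negPf (neq_lift i m)) mxE.
Qed.

Variables (c : R) (k : nat).

(** For k > 0 this is the coefficient of z^k in (z^i + (c / z)^i)(z^j + (c / z)^j), whose term in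
    z^(-i-j) cannot contribute. The guards account for the basis element 1 at index 0. *)
Definition cheb_entry (i j : nat) : R :=
  (i + j == k)%N%:R + c ^+ j * ((i == j + k)%N && (0 < j)%N)%:R
                    + c ^+ i * ((j == i + k)%N && (0 < i)%N)%:R.

Definition cheb_mx (n : nat) : 'M[R]_n := \matrix_(i < n, j < n) cheb_entry i j.

Lemma cheb_entryC (i j : nat) : cheb_entry i j = cheb_entry j i.
Proof. by rewrite /cheb_entry addnC addrAC. Qed.

Hypothesis k_gt0 : (0 < k)%N.

Lemma cheb_entry_out (n i j : nat) : (n <= i)%N -> (j < n + k)%N ->
  (k <= n)%N -> cheb_entry i j = c ^+ j * (i == j + k)%N%:R.
Proof.
move=> le_ni lt_j le_kn; rewrite /cheb_entry.
rewrite (_ : (j == i + k)%N = false) ?andFb ?mulr0 ?addr0; last by lia.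
(* At [j = 0] the term for [i + j == k] supplies exactly what the guard [0 < j] suppresses. *)
case: j lt_j => [|j] lt_j; first by rewrite andbF mulr0 addr0 addn0 mul1r.
by rewrite andbT (_ : (i + _ == k)%N = false) ?add0r //; lia.
Qed.

(** By [cheb_entry_out], row n + k + i has its only entry c^(n+i) in column n + i. By symmetry the
    last k columns behave alike, so [det_hook_block] applies with the same diagonal [E] twice. *)
Lemma det_cheb_mx_rec (n : nat) : \det (cheb_mx (n + k + k)) =
  (-1) ^+ k * c ^+ (k * (2 * n + k - 1)) * \det (cheb_mx n).
Proof.
pose E : 'M[R]_k := \matrix_(i, j) (c ^+ (n + j) *+ (i == j)).
have detE : \det E = \prod_(i < k) c ^+ (n + i).
  rewrite det_trig => [|]; first by apply: eq_bigr => i _; rewrite mxE eqxx.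
  by apply/is_trig_mxP => i j lt_ij; rewrite mxE -val_eqE /= ltn_eqF.
pose A := cheb_mx (n + k).
have -> : cheb_mx (n + k + k) =
    block_mx (block_mx (cheb_mx n) (ursubmx A) (dlsubmx A) (drsubmx A))
             (col_mx 0 E) (row_mx 0 E) 0.
  have outE (i : 'I_k) (j : 'I_(n + k)) :
      cheb_entry (n + k + i) j = (row_mx 0 E : 'M_(k, n + k)) i j.
    rewrite (cheb_entry_out (n := n + k)) ?leq_addr ?leq_addl //; last first.
      by have := ltn_ord j; lia.
    rewrite mxE; case: splitP => [j' | j'] ->.
      by rewrite mxE (_ : (_ == _)%N = false) ?mulr0 //; have := ltn_ord j'; lia.
    rewrite mxE -addnA [(k + i)%N]addnC addnA eqn_add2r eqn_add2l mulr_natr.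
    by rewrite val_eqE.
  have -> : block_mx (cheb_mx n) (ursubmx A) (dlsubmx A) (drsubmx A) = A.
    rewrite -[RHS]submxK; congr block_mx.
    by apply/matrixP => i j; rewrite !mxE.
  rewrite -[LHS]submxK; congr block_mx; apply/matrixP => i j.
  - by rewrite !mxE.
  - rewrite !mxE cheb_entryC outE.
    rewrite mxE; case: splitP => i' _; rewrite !mxE //.
    by rewrite eq_sym; case: eqVneq => [->|].
  - by rewrite -outE !mxE.
  - have lt_ik := ltn_ord i; have lt_jk := ltn_ord j.
    rewrite !mxE (cheb_entry_out (n := n + k)) /=; try lia.
    by rewrite (_ : (_ == _)%N = false) ?mulr0 //; lia.
rewrite det_hook_block detE -mulrA mulrAC; congr (_ * _ * _).
rewrite -big_split /=; under eq_bigr do rewrite -exprD.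
rewrite prodrXr; congr (c ^+ _).
(* The number of summands is freed from the fixed [k] to allow induction. *)
suff sumE m : (\sum_(i < m) (n + i + (n + i)) = m * (2 * n + m - 1))%N by exact: sumE.
elim: m => [|m IH]; first by rewrite big_ord0.
by rewrite big_ord_recr /= IH; case: (m) => [|?]; nia.
Qed.

(** Row 0 could be nonzero only in column k, which is cut off. *)
Lemma det_cheb_mx_le (n : nat) : (0 < n)%N -> (n <= k)%N -> \det (cheb_mx n) = 0.
Proof.
case: n => // n _ le_nk; rewrite (expand_det_row _ ord0) big1 // => j _.
have lt_jk : (j < k)%N := leq_trans (ltn_ord j) le_nk.
rewrite mxE /cheb_entry (_ : _ && _ = false); last by rewrite /=; lia.
by rewrite andbF !mulr0 !addr0 add0n ltn_eqF ?mul0r.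
Qed.

(** For indices at most k, i = j + k forces j = 0, which the guard excludes. Only the antidiagonal
    remains. *)
Lemma det_cheb_mxS : \det (cheb_mx k.+1) = (-1) ^+ 'C(k.+1, 2).
Proof.
rewrite -det_antidiag; congr (\det _); apply/matrixP => i j; rewrite !mxE.
have out (a b : 'I_k.+1) : (nat_of_ord a == b + k)%N && (0 < b)%N = false.
  by case: a b => [a lt_a] [b lt_b] /=; clear -lt_a; lia.
by rewrite /cheb_entry !out !mulr0 !addr0.
Qed.

(** Rows k + 1 and k - 1 are supported in column 1, with entries c and 1. The other possible entry
    of row k - 1, in column 2k - 1, is cut off by n < 2k. *)
Lemma det_cheb_mx_gap (n : nat) : (k.+1 < n)%N -> (n < 2 * k)%N ->
  \det (cheb_mx n) = 0.
Proof.
move=> lt_kn lt_nk.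
have lt_k1n : (k.-1 < n)%N by lia.
apply: (@det_proportional_rows _ _ (Ordinal lt_kn) (Ordinal lt_k1n) c).
  by rewrite -val_eqE /=; lia.
apply/rowP => j; rewrite !mxE /=.
have lt_j2k : (j.+1 < 2 * k)%N := leq_ltn_trans (ltn_ord j) lt_nk.
rewrite (cheb_entry_out (n := k.+1)) //; last by lia.
rewrite -addn1 [(j + k)%N]addnC eqn_add2l /cheb_entry.
have -> : (k.-1 + j == k)%N = (1 == j)%N by lia.
have -> : (k.-1 == j + k)%N = false by lia.
have -> : (j == k.-1 + k :> nat)%N && (0 < k.-1)%N = false by lia.
by rewrite !mulr0 !addr0; case: eqP => [<-|_]; rewrite ?mulr0.
Qed.

Lemma det_cheb_mx_mul2 (m : nat) : \det (cheb_mx (2 * k * m)) =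
  (-1) ^+ (k * m) * c ^+ (k * m * (2 * k * m - k - 1)).
Proof.
elim: m => [|m IH]; first by rewrite !muln0 det_mx00 mulr1.
have -> : (2 * k * m.+1 = 2 * k * m + k + k)%N by lia.
rewrite det_cheb_mx_rec IH mulrACA -!exprD; congr (_ ^+ _ * _ ^+ _); first lia.
(* At [m = 0] the subtraction in the old exponent truncates, harmlessly because of the factor
   [k * m]. *)
by case: m {IH} => [|m]; nia.
Qed.

Lemma det_cheb_mx_mul2S (m : nat) : \det (cheb_mx (2 * k * m + k.+1)) =
  (-1) ^+ (k * m + 'C(k.+1, 2)) * c ^+ (k * m * (2 * k * m + k.+1)).
Proof.
elim: m => [|m IH]; first by rewrite !muln0 det_cheb_mxS mulr1.
have -> : (2 * k * m.+1 + k.+1 = 2 * k * m + k.+1 + k + k)%N by lia.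
rewrite det_cheb_mx_rec IH mulrACA -!exprD; congr (_ ^+ _ * _ ^+ _); first lia.
by nia.
Qed.

(** The recursion preserves n modulo 2k, which leaves n < 2k. There n is neither 0 nor k + 1, and
    one of the two vanishing lemmas applies. *)
Lemma det_cheb_mx_eq0 (n : nat) : n != 0 %[mod 2 * k] -> n != k + 1 %[mod 2 * k] ->
  \det (cheb_mx n) = 0.
Proof.
elim/ltn_ind: n => n IH n0 nk1.
have [lt_n2k | le_2kn] := ltnP n (2 * k).
  move: n0 nk1; rewrite mod0n (modn_small lt_n2k) -lt0n => n0.
  have [le_nk _ | lt_kn nk1] := leqP n k; first exact: det_cheb_mx_le.
  apply: det_cheb_mx_gap => //; rewrite ltn_neqAle lt_kn andbT.
  by apply: contra nk1 => /eqP eq_n; rewrite addn1 eq_n modn_small.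
rewrite (_ : n = n - 2 * k + k + k)%N; last by rewrite -addnA addnn -mul2n subnK.
rewrite det_cheb_mx_rec IH ?mulr0 //.
- by clear -le_2kn k_gt0; lia.
- by rewrite -(modnDr _ (2 * k)) subnK.
- by rewrite -(modnDr _ (2 * k)) subnK.
Qed.
End SparseDeterminant.

(** * Evaluation of the Hankel determinants *)

Section HankelDeterminant.
Variables (R : comNzRingType) (x y : R).

Lemma moment_mchebM (k i j : nat) : (0 < k)%N ->
  moment x y k (mcheb x y i * mcheb x y j) = cheb_entry (x * y) k i j.
Proof.
move=> k_gt0; rewrite /cheb_entry; case: i => [|i].
  rewrite mul1r moment_mcheb andbF mulr0 addr0 add0n eqz_nat eq_sym.
  by rewrite (_ : (k%:Z == - j%:Z) = false) 1?(_ : (0 == j + k)%N = false) //; lia.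
rewrite moment_cheb !moment_mcheb andbT.
have -> : (k%:Z - i.+1%:Z == j%:Z) = (i.+1 + j == k)%N by lia.
have -> : (k%:Z - i.+1%:Z == - j%:Z) = (i.+1 == j + k)%N by lia.
have -> : (k%:Z + i.+1%:Z == j%:Z) = (j == i.+1 + k)%N by lia.
have -> : (k%:Z + i.+1%:Z == - j%:Z) = false by lia.
by rewrite mulr0 addr0.
Qed.

Lemma det_hankel_gt0 (n k : nat) : (0 < k)%N ->
  \det (\matrix_(i < n, j < n) path_sum x y (i + j) 0 k) =
  \det (cheb_mx (x * y) k n).
Proof.
move=> k_gt0; rewrite det_hankel; congr (\det _); apply/matrixP => i j.
by rewrite !mxE moment_mchebM.
Qed.

Lemma det_hankel0 (n : nat) :
  \det (\matrix_(i < n, j < n) path_sum x y (i + j) 0 0) =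
  2 ^+ (n - 1) * (x * y) ^+ 'C(n, 2).
Proof.
(* For i > 0 this is the constant term of (z^i + (xy / z)^i)^2. Index 0 contributes no factor 2,
   whence the exponent [n - 1]. *)
pose d i := if i is 0 then 1 else 2 * (x * y) ^+ i.
have entryE (i j : nat) :
    moment x y 0 (mcheb x y i * mcheb x y j) = d i * (i == j)%:R.
  case: i => [|i].
    by rewrite !mul1r moment_mcheb; case: j => [|j]; rewrite ?andbF mulr0 addr0.
  rewrite moment_cheb !moment_mcheb.
  have -> : (0 - i.+1%:Z == j%:Z) = false by lia.
  have -> : (0 + i.+1%:Z == j%:Z) = (i.+1 == j)%N by lia.
  have -> : (0 + i.+1%:Z == - j%:Z) = false by lia.
  have -> : (0 - i.+1%:Z == - j%:Z) && (0 < j)%N = (i.+1 == j)%N by lia.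
  by case: eqVneq => [<-|_]; rewrite /= /d; ring.
rewrite det_hankel det_trig => [|]; last first.
  by apply/is_trig_mxP => i j lt_ij; rewrite mxE entryE ltn_eqF ?mulr0.
under eq_bigr => i _ do rewrite mxE entryE eqxx mulr1.
case: n => [|n]; first by rewrite big_ord0 mulr1.
rewrite big_ord_recl mul1r big_split /= prodr_const card_ord subn1.
congr (_ * _); rewrite prodrXr -bin2_sum big_mkord big_ord_recl add0n.
by [].
Qed.
End HankelDeterminant.

Theorem theorem3 (n : nat) (hn : (0 < n)%N) :
  (forall k : nat, (0 < k)%N ->
     [/\ forall n1 : nat, (0 < n1)%N -> n = (2 * k * n1 - k + 1)%N ->
           \det (path_hankel n k%:Z) =
             (-1) ^+ (k * n1 + 'C(k, 2))
             * (indet_x * indet_y) ^+ (k * (n1 - 1) * (2 * k * n1 - k + 1)),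
         forall n1 : nat, (0 < n1)%N -> n = (2 * k * n1)%N ->
           \det (path_hankel n k%:Z) =
             (-1) ^+ (k * n1)
             * (indet_x * indet_y) ^+ (k * n1 * (2 * k * n1 - k - 1))
       & n != 0 %[mod 2 * k] -> n != k + 1 %[mod 2 * k] ->
           \det (path_hankel n k%:Z) = 0])
  /\ \det (path_hankel n 0) =
       2 ^+ (n - 1) * (indet_x * indet_y) ^+ 'C(n, 2).
Proof.
split=> [k k_gt0|]; last exact: det_hankel0.
rewrite /path_hankel det_hankel_gt0 //; split.
- case=> // n1 _ ->; rewrite subn1 /=.
  rewrite (_ : 2 * k * n1.+1 - k + 1 = 2 * k * n1 + k.+1)%N; last by lia.
  rewrite det_cheb_mx_mul2S //; congr (_ ^+ _ * _).
  (* With m = n1 - 1, Pascal's rule gives km + C(k+1, 2) = k n1 + C(k, 2). *)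
  by rewrite binS bin1; lia.
- by move=> n1 _ ->; apply: det_cheb_mx_mul2.
- exact: det_cheb_mx_eq0.
Qed.
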